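(* Let $\mathbb F$ be a finite field, let $0\le\mu\le\nu$ be integers, let $G\in\mathbb F^{k\times n}$ be an encoder of an $(n,k)$-block code with error-correcting capability $t$, let $T(D,D^{-1})=\sum_{i=-\mu}^{\mu}T_iD^i$ be an admissible $n\times n$ Laurent polynomial matrix, and let $S(D)=\sum_{i=\mu}^{\nu}S_iD^i\in\mathbb F^{k\times k}[D]$ with $S_\mu$ invertible. Put $G'(D)=S(D)\,G\,T^{-1}(D,D^{-1})$. Let $\mathbf u(D)\in\mathbb F^k[D]$ be an information sequence and let $\mathbf e(D)=\sum_{i\ge 0}\mathbf e_iD^i\in\mathbb F^n[D]$ be an error vector satisfying $$\mathrm{wt}\big((\mathbf e_i,\mathbf e_{i+1},\dots,\mathbf e_{i+2\mu})\big)\le t\quad\text{for all } i\ge 0.$$ Then the received data $\mathbf y(D)=\mathbf u(D)G'(D)+\mathbf e(D)\in\mathbb F^n[D]$ can be successfully decoded; that is, there is a map $\psi:\mathbb F^n[D]\to\mathbb F^k[D]$ (depending only on $G,S,T,t$) such that $\psi(\mathbf u(D)G'(D)+\mathbf e(D))=\mathbf u(D)$ for all such $\mathbf u(D)$ and $\mathbf e(D)$.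
   Context: All vectors are row vectors. $\mathbb F(D,D^{-1})$ denotes the ring of Laurent polynomials in $D$ over $\mathbb F$. For a constant vector, $\mathrm{wt}$ is the Hamming weight (number of nonzero components); $(\mathbf e_i,\dots,\mathbf e_{i+2\mu})$ is the concatenated vector of length $(2\mu+1)n$, with $\mathbf e_j=0$ for $j$ larger than the degree of $\mathbf e(D)$. An encoder $G\in\mathbb F^{k\times n}$ of an $(n,k)$-block code is a matrix of rank $k$; the code is $\{\mathbf uG:\mathbf u\in\mathbb F^k\}$. It has error-correcting capability $t$ if $t=\lfloor (d-1)/2\rfloor$, where $d$ is the minimum Hamming distance of the code (so $\mathbf u$ is uniquely determined by $\mathbf uG+\mathbf e$ whenever $\mathrm{wt}(\mathbf e)\le t$). A matrix $T(D,D^{-1})=\sum_{i=-\mu}^{\mu}T_iD^i$ with $T_i\in\mathbb F^{n\times n}$ is called admissible if it is invertible over $\mathbb F(D,D^{-1})$ and: (a) its determinant lies in $\mathbb F$; (b) the sets $C_i\subseteq\{1,\dots,n\}$ of indices of nonzero columns of $T_i$, $-\mu\le i\le\mu$ (some possibly empty), are pairwise disjoint with union $\{1,\dots,n\}$; (c) for every $i$, each row of $T_i$ has at most one nonzero entry. Successful decoding means recovering the information sequence $\mathbf u(D)$ from $\mathbf y(D)$. *)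

(* Defs.v *)
From HB Require Import structures.
From mathcomp Require Import all_boot all_order all_algebra.

Set Implicit Arguments.
Unset Strict Implicit.
Unset Printing Implicit Defensive.

Import Order.TTheory GRing.Theory Num.Theory.
Local Open Scope ring_scope.

Local Notation "x %:F" := (FracField.tofrac x) : ring_scope.

(* Hamming weight of a constant row vector. *)
Definition wt (F : finFieldType) (n : nat) (v : 'rV[F]_n) : nat :=
  #|[set j | v 0 j != 0]|.

(* The set of codewords of the block code generated by G. *)
Definition code (F : finFieldType) (k n : nat) (G : 'M[F]_(k, n)) :
    {set 'rV[F]_n} :=
  [set u *m G | u : 'rV[F]_k].

(* Relational because the minimum distance of a code with a single codeword
   is undefined: no d satisfies the predicate for such a code. *)
Definition min_distance (F : finFieldType) (n : nat) (C : {set 'rV[F]_n})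
    (d : nat) : Prop :=
  (exists c1 c2, [/\ c1 \in C, c2 \in C, c1 != c2 & wt (c1 - c2) = d]) /\
  (forall c1 c2, c1 \in C -> c2 \in C -> c1 != c2 -> (d <= wt (c1 - c2))%N).

Definition error_capability (F : finFieldType) (k n : nat)
    (G : 'M[F]_(k, n)) (t : nat) : Prop :=
  exists2 d : nat, min_distance (code G) d & t = (d.-1)./2.

(* The Laurent polynomial ring F(D, D^-1) is realized as the subring of those
   elements of the field of rational functions {fraction {poly F}} that become
   polynomials after multiplication by a power of D. *)
Definition ratD (F : finFieldType) : {fraction {poly F}} := ('X)%:F.

Definition laurent (F : finFieldType) (f : {fraction {poly F}}) : Prop :=
  exists (p : {poly F}) (m : nat), f * ratD F ^+ m = p%:F.

Definition poly_mx (F : finFieldType) (m n : nat) (A : 'M[{poly F}]_(m, n)) :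
    'M[{fraction {poly F}}]_(m, n) :=
  map_mx (fun p : {poly F} => p%:F) A.

Definition const_poly_mx (F : finFieldType) (m n : nat) (A : 'M[F]_(m, n)) :
    'M[{fraction {poly F}}]_(m, n) :=
  poly_mx (map_mx polyC A).

(* T(D, D^-1) = sum_(-mu <= i <= mu) T_i D^i; only the values of T_ on
   [-mu, mu] matter. *)
Definition Tmx (F : finFieldType) (n mu : nat) (T_ : int -> 'M[F]_n) :
    'M[{fraction {poly F}}]_n :=
  \sum_(i < mu.*2.+1)
    ratD F ^ (i%:Z - mu%:Z) *: const_poly_mx (T_ (i%:Z - mu%:Z)).

(* S(D) = sum_(mu <= i <= nu) S_i D^i *)
Definition Smx (F : finFieldType) (k mu nu : nat) (S_ : nat -> 'M[F]_k) :
    'M[{poly F}]_k :=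
  \sum_(mu <= i < nu.+1) 'X^i *: map_mx polyC (S_ i).

Definition nzcols (F : finFieldType) (m n : nat) (A : 'M[F]_(m, n)) :
    {set 'I_n} :=
  [set j | col j A != 0].

Definition invertible_laurent (F : finFieldType) (n : nat)
    (T : 'M[{fraction {poly F}}]_n) : Prop :=
  exists T' : 'M[{fraction {poly F}}]_n,
    [/\ forall i j, laurent (T' i j), T *m T' = 1%:M & T' *m T = 1%:M].

Definition admissible (F : finFieldType) (n mu : nat)
    (T_ : int -> 'M[F]_n) : Prop :=
  [/\ invertible_laurent (Tmx mu T_),
      exists c : F, \det (Tmx mu T_) = (c%:P)%:F,
      forall i j : int, - mu%:Z <= i <= mu%:Z -> - mu%:Z <= j <= mu%:Z ->
        i != j -> [disjoint nzcols (T_ i) & nzcols (T_ j)],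
      forall c : 'I_n,
        exists2 i : int, - mu%:Z <= i <= mu%:Z & c \in nzcols (T_ i)
    & forall (i : int) (r : 'I_n), - mu%:Z <= i <= mu%:Z ->
        (wt (row r (T_ i)) <= 1)%N].

(* G'(D) = S(D) G T^-1(D, D^-1); invmx is the inverse of T(D, D^-1) since
   an admissible matrix is invertible. *)
Definition Gprime (F : finFieldType) (k n mu nu : nat) (G : 'M[F]_(k, n))
    (S_ : nat -> 'M[F]_k) (T_ : int -> 'M[F]_n) :
    'M[{fraction {poly F}}]_(k, n) :=
  poly_mx (Smx mu nu S_) *m const_poly_mx G *m invmx (Tmx mu T_).

(* F^n[D] is identified with 'rV[{poly F}]_n; coef_rv v i is the coefficient
   vector of D^i in v(D), equal to 0 beyond the degree. *)
Definition coef_rv (F : finFieldType) (n : nat) (v : 'rV[{poly F}]_n)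
    (i : nat) : 'rV[F]_n :=
  map_mx (fun p : {poly F} => p`_i) v.

(* The concatenation (e_i, ..., e_(i+2mu)), of length (2mu+1)n: mxvec reads
   the matrix with these rows in row-major order. *)
Definition window (F : finFieldType) (n mu : nat) (e : 'rV[{poly F}]_n)
    (i : nat) : 'rV[F]_(mu.*2.+1 * n) :=
  mxvec (\matrix_(j < mu.*2.+1) coef_rv e (i + j)).

(* Main.v *)
(** Since the column supports of the [T_i] partition the columns, T = T0 * Delta
    with T0 an invertible constant matrix and Delta a diagonal matrix of powers
    D^i, |i| <= mu.  Hence D^mu T^-1 is polynomial, which makes u G' polynomial.
    Multiplying y on the right by D^mu T turns the code part into
    D^mu u S G, whose coefficients are codewords of the block code, and the
    error into e D^mu T, each coefficient of which is a sum of vectors e_l T_j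
    with l ranging over one window; as rows of T_j have weight at most 1, it has
    weight at most t.  So two transmissions with the same y differ by codewords
    of weight at most 2t < d, hence by 0, and S is nonsingular. *)
Require Import Defs.
From Stdlib Require Import ClassicalEpsilon.
From mathcomp Require Import all_boot all_order all_algebra zify.

Set Implicit Arguments.
Unset Strict Implicit.
Unset Printing Implicit Defensive.

Import Order.TTheory GRing.Theory Num.Theory.
Local Open Scope ring_scope.

(** * Hamming weight, and codewords of small weight *)

Section Weight.
Variables (F : finFieldType).

Lemma wtE n (v : 'rV[F]_n) : wt v = (\sum_j (v 0%R j != 0%R))%N.
Proof. by rewrite /wt -sum1dep_card big_mkcond. Qed.

Lemma wt0 n : wt (0 : 'rV[F]_n) = 0%N.
Proof. by rewrite wtE big1 // => j _; rewrite mxE eqxx. Qed.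

Lemma wtN n (v : 'rV[F]_n) : wt (- v) = wt v.
Proof. by rewrite !wtE; apply: eq_bigr => j _; rewrite mxE oppr_eq0. Qed.

Lemma wtD n (v w : 'rV[F]_n) : (wt (v + w) <= wt v + wt w)%N.
Proof.
rewrite !wtE -big_split; apply: leq_sum => j _; rewrite mxE.
have [->|_] /= := eqVneq (v 0 j) 0; first by rewrite add0r.
exact: leq_trans (leq_b1 _) (leq_addr _ _).
Qed.

Lemma wt_sum n (I : finType) (f : I -> 'rV[F]_n) :
  (wt (\sum_i f i) <= \sum_i wt (f i))%N.
Proof.
elim/big_ind2: _ => [|v p w q Hv Hw|//]; first by rewrite wt0.
exact: leq_trans (wtD v w) (leq_add Hv Hw).
Qed.

Lemma wtZ n (a : F) (v : 'rV[F]_n) : wt (a *: v) = ((a != 0%R) * wt v)%N.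
Proof.
rewrite !wtE big_distrr; apply: eq_bigr => j _ /=.
by rewrite mxE mulf_eq0 negb_or mulnb.
Qed.

(** [v *m A] combines the rows of [A] with the entries of [v] as coefficients, so each nonzero entry
    contributes at most 1. *)
Lemma wt_mulmx m n (v : 'rV[F]_m) (A : 'M[F]_(m, n)) :
  (forall r, (wt (row r A) <= 1)%N) -> (wt (v *m A) <= wt v)%N.
Proof.
move=> wtA; rewrite mulmx_sum_row [wt v]wtE.
apply: leq_trans (wt_sum _) _; apply: leq_sum => r _.
by rewrite wtZ -[leqRHS]muln1 leq_mul2l wtA orbT.
Qed.

Lemma wt_mxvec m n (A : 'M[F]_(m, n)) :
  wt (mxvec A) = (\sum_i wt (row i A))%N.
Proof.
rewrite wtE (reindex _ (curry_mxvec_bij _ _)) /=.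
under [RHS]eq_bigr => i _ do rewrite wtE.
by rewrite pair_bigA; apply: eq_bigr => -[i j] _ /=; rewrite mxvecE mxE.
Qed.

Lemma wt_window n mu (e : 'rV[{poly F}]_n) i :
  wt (window mu e i) = (\sum_(j < mu.*2.+1) wt (coef_rv e (i + j)))%N.
Proof.
by rewrite wt_mxvec; apply: eq_bigr => j _; rewrite rowK.
Qed.

(** A nonzero codeword is at distance at least [d] from the codeword 0, whereas [t.*2 < d]. *)
Lemma code_diff_eq0 k n t (G : 'M[F]_(k, n)) (u : 'rV[F]_k) :
  error_capability G t -> (wt (u *m G) <= t.*2)%N -> u *m G = 0.
Proof.
case=> d [[c1 [c2 [_ _ c12 wt12]]] dmin] -> wtu; apply/eqP/negPn/negP => uG0.
(* At [d = 0] the truncated [d.-1] would break [t.*2 < d]. *)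
have d_gt0 : (0 < d)%N.
  rewrite -wt12 lt0n cards_eq0; apply: contraNneq c12 => /setP c120.
  rewrite -subr_eq0; apply/eqP/rowP => j; move: (c120 j).
  by rewrite inE inE => /negbFE/eqP ->; rewrite mxE.
have := dmin (u *m G) 0 (imset_f _ _) _ uG0; rewrite subr0.
have C0 : (0 : 'rV_n) \in code G by apply/imsetP; exists 0; rewrite ?mul0mx.
by move=> /(_ isT C0); lia.
Qed.

End Weight.

(** * Coefficients of polynomial vectors, and embedding into rational functions *)

Section PolyMatrices.
Variables (F : finFieldType).

Lemma coef_rvB n (v w : 'rV[{poly F}]_n) i :
  coef_rv (v - w) i = coef_rv v i - coef_rv w i.
Proof. by apply/rowP => j; rewrite !mxE coefB. Qed.

Lemma coef_rv_mulmx m n (v : 'rV[{poly F}]_m) (A : 'M[{poly F}]_(m, n)) i :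
  coef_rv (v *m A) i =
  \sum_(j < i.+1) coef_rv v (i - j) *m map_mx (coefp j) A.
Proof.
apply/rowP => c; rewrite !mxE coef_sum summxE.
under eq_bigr => r _ do rewrite coefMr.
rewrite exchange_big; apply: eq_bigr => j _; rewrite mxE.
by apply: eq_bigr => r _; rewrite !mxE.
Qed.

Lemma coef_rv_mulmxC m n (v : 'rV[{poly F}]_m) (A : 'M[F]_(m, n)) i :
  coef_rv (v *m map_mx polyC A) i = coef_rv v i *m A.
Proof.
apply/rowP => c; rewrite !mxE coef_sum; apply: eq_bigr => r _.
by rewrite !mxE coefMC.
Qed.

Lemma coef_rv_inj n (v w : 'rV[{poly F}]_n) :
  (forall i, coef_rv v i = coef_rv w i) -> v = w.
Proof.
move=> vw; apply/rowP => j; apply/polyP => i.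
by have /rowP/(_ j) := vw i; rewrite !mxE.
Qed.

Lemma poly_mxM m n p (A : 'M[{poly F}]_(m, n)) (B : 'M[{poly F}]_(n, p)) :
  poly_mx (A *m B) = poly_mx A *m poly_mx B.
Proof. exact: map_mxM. Qed.

Lemma poly_mxXn m n (A : 'M[{poly F}]_(m, n)) i :
  poly_mx ('X^i *: A) = ratD F ^+ i *: poly_mx A.
Proof. by rewrite /poly_mx map_mxZ rmorphXn. Qed.

Lemma ratD_neq0 : ratD F != 0.
Proof. by rewrite /ratD tofrac_eq0 polyX_eq0. Qed.

(** Multiplying by the adjugate leaves [\det A] times [v], and a domain allows cancelling this
    scalar. *)
Lemma det_neq0_mulmx0 (R : idomainType) m n (v : 'M[R]_(m, n)) (A : 'M[R]_n) :
  \det A != 0 -> v *m A = 0 -> v = 0.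
Proof.
move=> detA vA0; have : v *m A *m \adj A = 0 by rewrite vA0 mul0mx.
rewrite -mulmxA mul_mx_adj mul_mx_scalar => /matrixP v0; apply/matrixP => i j.
by have /eqP := v0 i j; rewrite !mxE mulf_eq0 (negPf detA) => /eqP.
Qed.

End PolyMatrices.

(** * Polynomial forms of [T] and [S]: error weight, factorization, inverse *)

Section Shifted.
Variables (F : finFieldType).

(* D^mu T(D, D^-1) and D^-mu S(D), as polynomial matrices. *)
Definition Tshift n mu (T_ : int -> 'M[F]_n) : 'M[{poly F}]_n :=
  \sum_(j < mu.*2.+1) 'X^j *: map_mx polyC (T_ (j%:Z - mu%:Z)).

Definition Sshift k mu nu (S_ : nat -> 'M[F]_k) : 'M[{poly F}]_k :=
  \sum_(mu <= i < nu.+1) 'X^(i - mu) *: map_mx polyC (S_ i).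

Lemma SmxE k mu nu (S_ : nat -> 'M[F]_k) :
  Smx mu nu S_ = 'X^mu *: Sshift mu nu S_.
Proof.
rewrite scaler_sumr; apply: eq_big_nat => i /andP[mui _].
by rewrite scalerA -exprD subnKC.
Qed.

(** Evaluation at [D = 0] commutes with the determinant and leaves only [S_ mu]. *)
Lemma det_Sshift k mu nu (S_ : nat -> 'M[F]_k) :
  (mu <= nu)%N -> S_ mu \in unitmx -> \det (Sshift mu nu S_) != 0.
Proof.
move=> munu; rewrite unitmxE unitfE; apply: contraNneq => detS0.
have <- : map_mx (horner_eval 0) (Sshift mu nu S_) = S_ mu.
  rewrite /Sshift big_nat_recl // subnn scale1r.
  apply/matrixP => i j; rewrite !mxE summxE !horner_evalE hornerD hornerC.
  rewrite horner_sum big_nat big1 ?addr0 // => l /andP[mul _].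
  by rewrite !mxE hornerM hornerXn subSn // expr0n mul0r.
by rewrite det_map_mx detS0 rmorph0.
Qed.

Lemma poly_mx_Tshift n mu (T_ : int -> 'M[F]_n) :
  poly_mx (Tshift mu T_) = ratD F ^+ mu *: Tmx mu T_.
Proof.
rewrite /poly_mx raddf_sum scaler_sumr; apply: eq_bigr => j _.
rewrite scalerA; apply: etrans (poly_mxXn _ _) _; congr (_ *: _).
by rewrite !exprnP -expfzDr ?ratD_neq0 // addrC subrK.
Qed.

Lemma coef_Tshift n mu (T_ : int -> 'M[F]_n) j :
  map_mx (coefp j) (Tshift mu T_) =
  if (j < mu.*2.+1)%N then T_ (j%:Z - mu%:Z) else 0.
Proof.
apply/matrixP => r c; rewrite !mxE summxE /= coef_sum.
under eq_bigr => i _ do rewrite !mxE coefMC coefXn.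
case: ltnP => [ltj|lej].
  rewrite (bigD1 (Ordinal ltj)) //= eqxx mul1r big1 ?addr0 // => i neqi.
  by rewrite -val_eqE eq_sym in neqi; rewrite (negPf neqi) mul0r.
rewrite big1 ?mxE // => i _; suff /negPf-> : j != i by rewrite mul0r.
by rewrite gtn_eqF // (leq_trans _ lej).
Qed.

(** With [N = mu.*2], the left side runs over the error indices entering the coefficient of [D^m].
    They fit in the window starting at [m - N]; for [m < N] the subtraction truncates to 0 and only
    the first [m.+1] places are used. *)
Lemma sum_window (f : nat -> nat) N m :
  (\sum_(j < m.+1) (if j < N.+1 then f (m - j) else 0)
    <= \sum_(j < N.+1) f (m - N + j))%N.
Proof.
have [leNm|ltmN] := leqP N m.
  rewrite -big_mkcond -(big_ord_widen m.+1 (fun j => f (m - j)%N)) //.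
  rewrite (reindex_inj rev_ord_inj) leq_sum //= => j _.
  by rewrite eq_leq //; congr f; have := ltn_ord j; lia.
rewrite (reindex_inj rev_ord_inj) /=.
have -> : (m - N)%N = 0%N by lia.
have -> : N.+1 = (m.+1 + (N - m))%N by lia.
rewrite [leqRHS]big_split_ord /=.
apply: leq_trans (leq_addr _ _); apply: leq_sum => j _.
by case: ifP => // _; rewrite eq_leq //; congr f; have := ltn_ord j; lia.
Qed.

Lemma wt_error n mu t (T_ : int -> 'M[F]_n) (e : 'rV[{poly F}]_n) m :
  admissible mu T_ -> (forall i, (wt (window mu e i) <= t)%N) ->
  (wt (coef_rv (e *m Tshift mu T_) m) <= t)%N.
Proof.
case=> _ _ _ _ wtT /(_ (m - mu.*2)%N); apply: leq_trans.
rewrite wt_window coef_rv_mulmx; apply: leq_trans (wt_sum _) _.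
apply: leq_trans (sum_window (fun j => wt (coef_rv e j)) _ _).
apply: leq_sum => j _; rewrite coef_Tshift.
case: ifP => [ltj|_]; last by rewrite mulmx0 wt0.
by apply: wt_mulmx => r; apply: wtT; lia.
Qed.

Lemma Tshift_factor n mu (T_ : int -> 'M[F]_n) : admissible mu T_ ->
  exists (T0 : 'M[F]_n) (h : 'I_n -> nat), (forall c, (h c <= mu.*2)%N) /\
    Tshift mu T_ = map_mx polyC T0 *m diag_mx (\row_c 'X^(h c)).
Proof.
case=> _ _ disjT covT _.
have : forall c, exists2 j : nat, (j <= mu.*2)%N &
    c \in nzcols (T_ (j%:Z - mu%:Z)).
  move=> c; have [i ile ci] := covT c; exists (absz (i + mu%:Z)); first by lia.
  by rewrite (_ : _ - _ = i) //; lia.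
case/fin_all_exists2 => h leh ch.
(* Column [c] is nonzero in a single [T_ i], with [i = h c - mu]; [T0] gathers these columns. *)
exists (\matrix_(r, c) T_ ((h c)%:Z - mu%:Z) r c), h; split=> //.
apply/matrixP => r c; rewrite mul_mx_diag !mxE summxE.
rewrite (bigD1 (Ordinal (leh c : h c < mu.*2.+1)%N)) //= big1 => [|j neqj].
  by rewrite addr0 !mxE mulrC.
rewrite -val_eqE /= in neqj; rewrite !mxE; have := ltn_ord j => ltj.
have /disjointFl/(_ (ch c)) : [disjoint nzcols (T_ (j%:Z - mu%:Z))
    & nzcols (T_ ((h c)%:Z - mu%:Z))].
  by have := leh c => lehc; apply: disjT; lia.
by rewrite inE => /negbFE/eqP/colP/(_ r); rewrite !mxE => ->; rewrite mulr0.
Qed.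

Lemma Tshift_quasi_inverse n mu (T_ : int -> 'M[F]_n) : admissible mu T_ ->
  exists Q : 'M[{poly F}]_n, Q *m Tshift mu T_ = ('X^(mu.*2))%:M.
Proof.
move=> adT; have [T0 [h [leh PE]]] := Tshift_factor adT.
have [[T' [_ TT' _]] _ _ _ _] := adT.
(* If [T0] were singular, the factorization would force [\det T = 0], against the invertibility of
   [T]. *)
have T0u : T0 \in unitmx.
  rewrite unitmxE unitfE; apply/eqP => detT0.
  have : \det (poly_mx (Tshift mu T_)) = 0.
    by rewrite /poly_mx det_map_mx PE det_mulmx det_map_mx detT0
         !(rmorph0, mul0r).
  move/eqP; rewrite poly_mx_Tshift detZ mulf_eq0 !expf_eq0.
  rewrite (negPf (ratD_neq0 _)) !andbF /= => /eqP detT.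
  have := congr1 determinant TT'.
  by rewrite det_mulmx detT mul0r det1 => /esym/eqP; rewrite oner_eq0.
(* The diagonal factor is inverted up to ['X^(mu.*2)]; the exponents do not truncate since
   [h c <= mu.*2]. *)
exists (diag_mx (\row_c 'X^(mu.*2 - h c)) *m map_mx polyC (invmx T0)).
rewrite PE mulmxA -[in X in X *m _]mulmxA -map_mxM mulVmx // map_mx1 mulmx1.
rewrite mulmx_diag -diag_const_mx; congr diag_mx; apply/rowP => c.
by rewrite !mxE -exprD subnK.
Qed.

(** Cancelling [D^mu] in [Q (D^mu T) = D^(2 mu)] identifies [Q]; the factor [D^mu] of [S] then makes
    [S G T^-1] polynomial. *)
Lemma poly_mx_quasi_inverse n mu (T_ : int -> 'M[F]_n) Q :
  admissible mu T_ -> Q *m Tshift mu T_ = ('X^(mu.*2))%:M ->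
  poly_mx Q = ratD F ^+ mu *: invmx (Tmx mu T_).
Proof.
case=> -[T' [_ TT' _]] _ _ _ _ /(congr1 (@poly_mx F n n)).
have [Tu _] := mulmx1_unit TT'.
rewrite poly_mxM poly_mx_Tshift -scalemx1 poly_mxXn /poly_mx map_mx1.
rewrite -addnn exprD -scalemxAr -scalerA => /scalerI.
rewrite expf_neq0 ?ratD_neq0 // => /(_ isT).
by move=> /(congr1 (mulmx^~ (invmx (Tmx mu T_))));
  rewrite mulmxK // -scalemxAl mul1mx.
Qed.

End Shifted.

Theorem theorem2p4 (F : finFieldType) (k n mu nu t : nat)
    (G : 'M[F]_(k, n)) (S_ : nat -> 'M[F]_k) (T_ : int -> 'M[F]_n)
    (hmunu : (mu <= nu)%N)
    (hG : \rank G = k)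
    (ht : error_capability G t)
    (hT : admissible mu T_)
    (hS : S_ mu \in unitmx) :
  exists psi : 'rV[{poly F}]_n -> 'rV[{poly F}]_k,
    forall (u : 'rV[{poly F}]_k) (e : 'rV[{poly F}]_n),
      (forall i : nat, (wt (window mu e i) <= t)%N) ->
      exists y : 'rV[{poly F}]_n,
        poly_mx y = poly_mx u *m Gprime mu nu G S_ T_ + poly_mx e /\
        psi y = u.
Proof.
have [Q QP] := Tshift_quasi_inverse hT.
set S := Sshift mu nu S_; set P := Tshift mu T_ in QP.
(* The received word in polynomial form: the [D^mu] of [S(D)] is absorbed into [Q]. *)
pose send (u : 'rV[{poly F}]_k) (e : 'rV[{poly F}]_n) :=
  u *m S *m map_mx polyC G *m Q + e.
pose bounded (e : 'rV[{poly F}]_n) := forall i, (wt (window mu e i) <= t)%N.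
have send_inj u1 u2 e1 e2 :
    bounded e1 -> bounded e2 -> send u1 e1 = send u2 e2 -> u1 = u2.
  move=> be1 be2 /(congr1 (mulmx^~ P)); rewrite !mulmxDl -!mulmxA QP !mulmxA.
  rewrite !mul_mx_scalar => eqy.
  (* Since [Q *m P] is ['X^(mu.*2)], the code parts differ by [w G], which must balance the
     errors. *)
  pose w := 'X^(mu.*2) *: ((u1 - u2) *m S).
  have wG : w *m map_mx polyC G = (e2 - e1) *m P.
    rewrite /w -scalemxAl !mulmxBl scalerBr.
    by apply/eqP; rewrite subr_eq addrAC eq_sym subr_eq eq_sym addrC -eqy addrC.
  have wG0 : w *m map_mx polyC G = 0.
    (* Each coefficient of [w G] is a codeword, and as a difference of two error coefficients it has
       weight at most [t + t]. *)
    apply: coef_rv_inj => i; rewrite coef_rv_mulmxC.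
    rewrite (code_diff_eq0 ht); first by apply/rowP => j; rewrite !mxE coef0.
    rewrite -coef_rv_mulmxC wG mulmxBl coef_rvB -addnn.
    apply: leq_trans (wtD _ _) _.
    by rewrite wtN leq_add // wt_error.
  have : w = 0.
    (* Full row rank gives [G] a constant right inverse. *)
    rewrite -[w]mulmx1 -(map_mx1 polyC) -(mulmxVp (_ : row_free G));
      last by rewrite /row_free hG.
    by rewrite map_mxM mulmxA wG0 mul0mx.
  rewrite /w scalemxAr => /det_neq0_mulmx0 u0; apply/eqP.
  rewrite -subr_eq0 u0 // detZ mulf_neq0 ?det_Sshift //.
  by rewrite !expf_neq0 ?polyX_eq0.
pose sent y u := exists2 e, bounded e & y = send u e.
(* The decoder chooses some [u] compatible with [y]; [send_inj] makes it unique. On words that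
   cannot be received its value is arbitrary. *)
exists (fun y => epsilon (inhabits 0) (sent y)) => u e be.
exists (send u e); split.
  rewrite /poly_mx map_mxD -!/(poly_mx _) !poly_mxM.
  rewrite (poly_mx_quasi_inverse hT QP) /Gprime SmxE poly_mxXn.
  by rewrite -!scalemxAl -!scalemxAr !mulmxA.
have := epsilon_spec (inhabits 0) (sent (send u e)).
by case=> [|e' be' /send_inj/esym]; [exists u, e | apply].
Qed.
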